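(* Let $S\subsetneq\mathbb{R}^n$ be a proper basic semialgebraic set. Then $\mathbb{R}^{n+1}\setminus(S\times\{0\})$ is a polynomial image of $\mathbb{R}^{n+1}$.
   Context: A basic semialgebraic set in $\mathbb{R}^n$ is a set of the form $\{x\in\mathbb{R}^n: g_1(x)*_1 0,\ldots,g_r(x)*_r0\}$, where $g_1,\ldots,g_r\in\mathbb{R}[x_1,\ldots,x_n]$ and each $*_i$ is either $>$ or $\geq$. A set $T\subset\mathbb{R}^{m}$ is a polynomial image of $\mathbb{R}^{m}$ if $T=f(\mathbb{R}^{m})$ for some map $f:\mathbb{R}^{m}\to\mathbb{R}^{m}$ with polynomial components. *)

(* Defs.v *)
From mathcomp Require Import all_boot all_order all_algebra.
From mathcomp Require Import classical_sets reals.
From mathcomp Require Import mpoly.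

Set Implicit Arguments.
Unset Strict Implicit.
Unset Printing Implicit Defensive.

Import Order.TTheory GRing.Theory Num.Theory.

Local Open Scope ring_scope.
Local Open Scope classical_set_scope.

Definition mpoly_at (R : realType) (n : nat) (p : {mpoly R[n]})
    (x : 'rV[R]_n) : R :=
  p.@[fun i => x ord0 i].

(* [strict i] selects the relation of the i-th inequality: > if true, >= if
   false. *)
Definition basic_semialgebraic (R : realType) (n : nat)
    (S : set 'rV[R]_n) : Prop :=
  exists (r : nat) (g : 'I_r -> {mpoly R[n]}) (strict : 'I_r -> bool),
    S = [set x | forall i : 'I_r,
                   if strict i then mpoly_at (g i) x > 0
                   else mpoly_at (g i) x >= 0].

Definition mpoly_map (R : realType) (m : nat) (f : 'I_m -> {mpoly R[m]})
    (x : 'rV[R]_m) : 'rV[R]_m :=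
  \row_(i < m) mpoly_at (f i) x.

Definition polynomial_image (R : realType) (m : nat)
    (T : set 'rV[R]_m) : Prop :=
  exists f : 'I_m -> {mpoly R[m]}, T = range (mpoly_map f).

(* The Cartesian product, as a set of concatenated coordinate vectors. *)
Definition row_prod (R : realType) (m n : nat) (A : set 'rV[R]_m)
    (B : set 'rV[R]_n) : set 'rV[R]_(m + n) :=
  [set row_mx p.1 p.2 | p in A `*` B].

(* Main.v *)
Require Import Defs.
From mathcomp Require Import all_boot all_order all_algebra.
From mathcomp Require Import classical_sets reals boolp mpoly ring lra.

(** The theorem is proved by composing polynomial maps of [R^n x R].  If [p] is
    not in [S], the image of [(x, t) |-> (p + t x, t)] is the complement of
    [(R^n \ {p}) x {0}].  Now let [c = 1] if the [i]-th inequality is strict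
    and [c = 0] otherwise.  The map [(x, t) |-> (x, t ((t - c)^2 + g_i(x)))]
    is onto on each fibre (an odd cubic is onto), and the cubic has a nonzero
    root exactly when the [i]-th inequality fails at [x].  Hence it maps the
    complement of [A x {0}] onto the complement of [A' x {0}], where [A'] is
    [A] cut by the [i]-th inequality.  Applying these maps in turn cuts
    [R^n \ {p}] down to [S]. *)

Set Implicit Arguments.
Unset Strict Implicit.
Unset Printing Implicit Defensive.

Import Order.TTheory GRing.Theory Num.Theory.

Local Open Scope ring_scope.
Local Open Scope classical_set_scope.

Lemma cubic_onto (R : rcfType) (a b y : R) :
  exists t, t ^+ 3 + a * t ^+ 2 + b * t = y.
Proof.
pose p : {poly R} := 'X^3 + a *: 'X^2 + b *: 'X - y%:P.
have pE t : p.[t] = t ^+ 3 + a * t ^+ 2 + b * t - y by rewrite /p !hornerE.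
(* Multiplying this value of [M] by [M ^+ 2] splits [M ^+ 3] into one share bounding each
   lower-order term, with [M ^+ 2] to spare. Hence [p] is negative at [- M] and positive at [M]. *)
have [M ME] : exists M, M = 1 + `|a| + `|b| + `|y|.
  by exists (1 + `|a| + `|b| + `|y|).
have M1 : 1 <= M by rewrite ME -!addrA lerDl !addr_ge0.
have M3 : M ^+ 3 = M ^+ 2 + `|a| * M ^+ 2 + `|b| * M ^+ 2 + `|y| * M ^+ 2.
  by rewrite exprS {1}ME; ring.
have bnd c d : 0 <= d <= M ^+ 2 -> - (`|c| * M ^+ 2) <= c * d <= `|c| * M ^+ 2.
  move=> /andP[d0 dM].
  by rewrite -ler_norml normrM (ger0_norm d0) ler_wpM2l.
have /andP[a1 a2] : - (`|a| * M ^+ 2) <= a * M ^+ 2 <= `|a| * M ^+ 2.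
  by apply: bnd; rewrite sqr_ge0 lexx.
have /andP[b1 b2] : - (`|b| * M ^+ 2) <= b * M <= `|b| * M ^+ 2.
  by apply: bnd; apply/andP; split; nra.
have /andP[y1 y2] : - (`|y| * M ^+ 2) <= y * 1 <= `|y| * M ^+ 2.
  by apply: bnd; apply/andP; split; nra.
have M20 : 0 <= M ^+ 2 by rewrite sqr_ge0.
have [t _ /rootP] : exists2 t, - M <= t <= M & root p t.
  apply: poly_ivt; first by lra.
  rewrite !pE (_ : (- M) ^+ 3 = - M ^+ 3); last by ring.
  by rewrite sqrrN; apply/andP; split; lra.
by rewrite pE => /subr0_eq tE; exists t.
Qed.

Lemma polynomial_image_comp (R : realType) (m : nat)
    (h : 'I_m -> {mpoly R[m]}) (T : set 'rV[R]_m) :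
  polynomial_image T -> polynomial_image (mpoly_map h @` T).
Proof.
move=> [f ->]; exists (fun i => h i \mPo [tuple f j | j < m]).
have hf x : mpoly_map (fun i => h i \mPo [tuple f j | j < m]) x =
    mpoly_map h (mpoly_map f x).
  apply/rowP => i; rewrite !mxE /mpoly_at comp_mpoly_meval.
  by apply: meval_eq => j; rewrite tnth_mktuple !mxE.
apply/seteqP; split => [_ [_ [x _ <-] <-]|_ [x _ <-]]; first by exists x.
by exists (mpoly_map f x); [exists x|].
Qed.

Definition fiber_pt (R : realType) (n : nat) (x : 'rV[R]_n) (t : R) :
  'rV[R]_(n + 1) := row_mx x t%:M.

Lemma fiber_ptP (R : realType) (n : nat) (z : 'rV[R]_(n + 1)) :
  exists x t, z = fiber_pt x t.
Proof.
exists (lsubmx z), (rsubmx z ord0 ord0).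
by rewrite /fiber_pt -mx11_scalar hsubmxK.
Qed.

Lemma row_prod0_fiber (R : realType) (n : nat) (A : set 'rV[R]_n) x t :
  row_prod A [set (0 : 'rV[R]_1)] (fiber_pt x t) <-> A x /\ t = 0.
Proof.
split=> [[[u v] /= [Au ->]] /eq_row_mx[<- /esym/matrixP/(_ ord0 ord0)]|[Ax ->]].
  by rewrite !mxE eqxx mulr1n.
by exists (x, 0) => //=; rewrite /fiber_pt raddf0.
Qed.

(** Allows a polynomial map to be given by its base components [F] and its height [G]; the case
    split on indices is confined to this proof. *)
Lemma mpoly_map_fiber (R : realType) (n : nat) (F : 'I_n -> {mpoly R[n + 1]})
    (G : {mpoly R[n + 1]}) :
  exists h, forall z,
    mpoly_map h z = fiber_pt (\row_i mpoly_at (F i) z) (mpoly_at G z).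
Proof.
exists (fun i => match split i with inl j => F j | inr _ => G end) => z.
apply/rowP => i; rewrite /fiber_pt !mxE.
by case: (split i) => j; rewrite !mxE // ord1 eqxx mulr1n.
Qed.

Lemma mpoly_at_base (R : realType) (n : nat) (i : 'I_n) (x : 'rV[R]_n) t :
  mpoly_at 'X_(lshift 1 i) (fiber_pt x t) = x ord0 i.
Proof. by rewrite /mpoly_at mevalXU row_mxEl. Qed.

Lemma mpoly_at_height (R : realType) (n : nat) (x : 'rV[R]_n) t :
  mpoly_at 'X_(rshift n ord0) (fiber_pt x t) = t.
Proof. by rewrite /mpoly_at mevalXU row_mxEr mxE eqxx mulr1n. Qed.

Lemma polynomial_image_compl_punctured (R : realType) (n : nat)
    (p : 'rV[R]_n) :
  polynomial_image (~` (row_prod (~` [set p]) [set (0 : 'rV[R]_1)])).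
Proof.
pose T : {mpoly R[n + 1]} := 'X_(rshift n ord0).
have [h hE] := mpoly_map_fiber
  (fun i => (p ord0 i)%:MP_[n + 1] + T * 'X_(lshift 1 i)) T.
have {}hE x t : mpoly_map h (fiber_pt x t) = fiber_pt (p + t *: x) t.
  rewrite hE mpoly_at_height; congr fiber_pt; apply/rowP => i.
  rewrite !mxE /mpoly_at mevalD mevalM mevalC -!/(mpoly_at _ _).
  by rewrite mpoly_at_height mpoly_at_base.
exists h; apply/seteqP; split=> z.
  have [x [t ->]] := fiber_ptP z; rewrite /= row_prod0_fiber => /not_andP H.
  (* The map preserves the height [t]. At height 0 it is constant with base [p], so the preimage
     over [0] is an arbitrary choice; at any other height it is an affine bijection of the base. *)
  have [t0|t0] := eqVneq t 0.
    exists (fiber_pt 0 t) => //; rewrite hE scaler0 addr0.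
    by case: H => // /contrapT ->.
  exists (fiber_pt (t^-1 *: (x - p)) t) => //.
  by rewrite hE scalerA mulfV // scale1r addrC subrK.
move=> [w _ <-]; have [x [t ->]] := fiber_ptP w.
by rewrite /= hE row_prod0_fiber => -[+ t0]; rewrite t0 scale0r addr0; apply.
Qed.

(** A nonzero root [t] satisfies [(t - b%:R) ^+ 2 = - y]. Without shift this has a nonzero solution
    only for [y < 0]. With shift 1, the solution [1 + Num.sqrt (- y)] stays positive even at
    [y = 0], which captures the failure of a strict inequality. *)
Lemma cubic_nonzero_root (R : rcfType) (b : bool) (y : R) :
  (exists2 t, t != 0 & t * ((t - b%:R) ^+ 2 + y) = 0) <->
  ~ (if b then 0 < y else 0 <= y).
Proof.
split=> [[t t0 /eqP]|].
  rewrite mulf_eq0 (negbTE t0) /= => /eqP.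
  case: b => /= e y0; first by have := sqr_ge0 (t - 1); lra.
  have : 0 < t ^+ 2 by rewrite exprn_even_gt0.
  by move: e; rewrite subr0; lra.
case: b => /= /negP; rewrite -?leNgt -?ltNge => y0.
  exists (1 + Num.sqrt (- y)).
    by rewrite gt_eqF // ltr_pwDl // sqrtr_ge0.
  by rewrite [_ - 1]addrC addKr sqr_sqrtr ?oppr_ge0 // addNr mulr0.
exists (Num.sqrt (- y)); first by rewrite gt_eqF // sqrtr_gt0 oppr_gt0.
by rewrite subr0 sqr_sqrtr ?oppr_ge0 1?ltW // addNr mulr0.
Qed.

Lemma polynomial_image_compl_cut (R : realType) (n : nat) (A : set 'rV[R]_n)
    (g : {mpoly R[n]}) (b : bool) :
  polynomial_image (~` (row_prod A [set (0 : 'rV[R]_1)])) ->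
  polynomial_image (~` (row_prod
    (A `&` [set x | if b then mpoly_at g x > 0 else mpoly_at g x >= 0])
    [set (0 : 'rV[R]_1)])).
Proof.
pose T : {mpoly R[n + 1]} := 'X_(rshift n ord0).
have [h hE] := mpoly_map_fiber (fun i => 'X_(lshift 1 i))
  (T * ((T - (b%:R)%:MP_[n + 1]) ^+ 2
        + (g \mPo [tuple 'X_(lshift 1 i) | i < n]))).
have {}hE x t : mpoly_map h (fiber_pt x t) =
    fiber_pt x (t * ((t - b%:R) ^+ 2 + mpoly_at g x)).
  rewrite hE; congr fiber_pt.
    by apply/rowP => i; rewrite mxE mpoly_at_base.
  rewrite /mpoly_at mevalM mevalD rmorphXn /= mevalB mevalC.
  rewrite -[T.@[_]]/(mpoly_at _ _) mpoly_at_height comp_mpoly_meval.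
  congr (_ * (_ + _)); apply: meval_eq => i.
  by rewrite tnth_mktuple -[LHS]/(mpoly_at _ _) mpoly_at_base.
move=> /(polynomial_image_comp h); congr polynomial_image.
apply/seteqP; split=> [_ [w + <-]|z].
  have [x [t ->]] := fiber_ptP w.
  rewrite /= hE !row_prod0_fiber => nA [[Ax gx] t0].
  apply: (cubic_nonzero_root b (mpoly_at g x)).1 gx; exists t => //.
  by apply/eqP => t1; apply: nA.
have [x [s ->]] := fiber_ptP z; rewrite /= row_prod0_fiber => H.
suff [t nA tE] : exists2 t, ~ (A x /\ t = 0) &
    t * ((t - b%:R) ^+ 2 + mpoly_at g x) = s.
  by exists (fiber_pt x t); [rewrite /= row_prod0_fiber | rewrite hE tE].
have [s0|s0] := eqVneq s 0; last first.
  (* These are the coefficients of the expanded cubic. It has no constant term, so a preimage of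
     [s != 0] is itself nonzero and lies in the allowed set. *)
  have [t tE] := cubic_onto (- (2 * b%:R)) (b%:R ^+ 2 + mpoly_at g x) s.
  exists t; last by rewrite -tE; ring.
  by move=> [_ t0]; case/eqP: s0; rewrite -tE t0; ring.
(* At height [s = 0], the root [t = 0] is admissible when [x] is outside [A]. Otherwise the
   inequality fails at [x] and supplies a nonzero root. *)
have [Ax|nAx] := pselect (A x); last first.
  by exists 0; [case | rewrite s0 mul0r].
have /cubic_nonzero_root[t t0 tE] :
    ~ (if b then 0 < mpoly_at g x else 0 <= mpoly_at g x).
  by move=> gx; apply: H.
by exists t; [case=> _ /eqP; rewrite (negbTE t0) | rewrite s0].
Qed.

Theorem theorem2p1 (R : realType) (n : nat) (S : set 'rV[R]_n)
    (S_basic : basic_semialgebraic S) (S_proper : S `<` setT) :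
  polynomial_image (~` (row_prod S [set (0 : 'rV[R]_1)])).
Proof.
have [r [g [strict SE]]] := S_basic.
have [p Sp] : exists p, ~ S p.
  by apply/existsNP => ST; case: S_proper => _; apply => x _.
pose cond i x := if strict i then mpoly_at (g i) x > 0
                 else mpoly_at (g i) x >= 0.
(* Induction on the list of inequalities already imposed, starting from the space punctured at
   [p]. *)
have cuts (s : seq 'I_r) : polynomial_image (~` (row_prod
    [set x | x <> p /\ forall i, i \in s -> cond i x] [set (0 : 'rV[R]_1)])).
  elim: s => [|i s].
    have := polynomial_image_compl_punctured p.
    congr (polynomial_image (~` row_prod _ _)).
    by apply/seteqP; split=> x //= [].
  move=> /(polynomial_image_compl_cut (g i) (strict i)).
  congr (polynomial_image (~` row_prod _ _)).
  apply/seteqP; split=> x /=.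
    move=> [[xp xs] xi]; split=> // j; rewrite inE => /orP[/eqP -> //|].
    exact: xs.
  move=> [xp xs]; split; last by apply: (xs i); rewrite mem_head.
  by split=> // j js; apply: xs; rewrite inE js orbT.
(* Once all inequalities are imposed, [x <> p] follows from them because [p] is outside [S], so the
   set is exactly [S]. *)
have := cuts (enum 'I_r); congr (polynomial_image (~` row_prod _ _)).
rewrite SE; apply/seteqP; split=> x /=.
  by move=> [_ xs] i; apply: xs; rewrite mem_enum.
by move=> xS; split=> [xp|i _]; [apply: Sp; rewrite SE -xp | apply: xS].
Qed.
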